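(* Every deduction in the system $\mathbf{IPF}^I$ can be transformed into a deduction in normal form, i.e. one containing neither maximal formulas nor maximal segments, with the same conclusion and with undischarged assumptions among those of the original deduction.
   Context: $\mathbf{IPF}$ is a natural deduction system for a first-order language without function symbols whose terms are constants and parameters, with a primitive predicate $\exists!$ (''exists''), identity, and connectives $\land,\lor,\rightarrow,\leftrightarrow,\bot,\forall,\exists$; $A^x_t$ is the result of replacing $x$ by $t$ in $A$. Its rules are the standard intuitionist rules for $\land,\rightarrow,\lor,\leftrightarrow$; $\bot E$ with atomic conclusions only; $\forall I$ (from a deduction of $A^x_a$ infer $\forall xA$ discharging the assumption $\exists!a$, $a$ not in $A$ or other open assumptions); $\forall E$ (from $\forall xA$ and $\exists!t$ infer $A^x_t$); $\exists I$ (from $A^x_t$ and $\exists!t$ infer $\exists xA$); $\exists E$ (from $\exists xA$ and a deduction of $C$ from $A^x_a,\exists!a$ infer $C$, discharging these, $a$ not in $A$, $C$ or other open assumptions); $=I$ (axiom $t=t$); $=E$ (from $t_1=t_2$ and $A^x_{t_1}$ infer $A^x_{t_2}$, $A$ atomic, $t_1\neq t_2$). $\mathbf{IPF}^I$ adds a binary quantifier: if $F,G$ are formulas and $x$ a variable, $Ix[F,G]$ is a formula binding $x$ (''The $F$ is $G$''), with rules (all parameters $a,b$ fresh: not occurring in $F$, $G$, $C$, nor in undischarged assumptions of the relevant subdeduction other than those displayed, and $a$ distinct from $t$): $II$: from $F^x_t$, $G^x_t$, $\exists!t$ and a deduction of $a=t$ from $F^x_a,\exists!a$ (discharged), infer $Ix[F,G]$.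 $IE^{1p}$: from $Ix[F,G]$, $F^x_t$, $\exists!t$, a deduction of $a=t$ from $F^x_a,\exists!a$, and a deduction of $C$ from $F^x_b,G^x_b,\exists!b$ (all these discharged), infer $C$. $IE^{2p}$: from $Ix[F,\exists!x]$, $\exists!t_1$, $\exists!t_2$, $F^x_{t_1}$, $F^x_{t_2}$, $A^x_{t_1}$ infer $A^x_{t_2}$ ($A$ atomic). $IE^{3p}$: from $Ix[F,\exists!x]$ and a deduction of $C$ from $F^x_a,\exists!a$ (discharged) infer $C$. $IE^{4p}$: from $Ix[F,x=t_2]$, $\exists!t_1$, $\exists!t_2$, $F^x_{t_1}$, $A^x_{t_1}$ infer $A^x_{t_2}$ ($A$ atomic). $IE^{5p}$: from $Ix[F,x=t]$, $\exists!t$ and a deduction of $C$ from $F^x_a,\exists!a$ (discharged) infer $C$. The major premise of an elimination rule is its first listed premise (the one containing the governed connective). A maximal formula is an occurrence that is the conclusion of an introduction rule and major premise of an elimination rule. Del-rules: $\lor E$, $\exists E$, $IE^{1p}$, $IE^{3p}$, $IE^{5p}$. A segment is a sequence $C_1,\dots,C_n$ ($n\ge 2$) of occurrences of a formula where $C_1$ is not the conclusion of a del-rule, $C_n$ is not a minor premise of a del-rule, and each $C_i$ ($i<n$) is a minor premise of a del-rule with conclusion $C_{i+1}$; it is maximal if $C_n$ is the major premise of an elimination rule. *)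

(* Defs.v *)
From HB Require Import structures.
From mathcomp Require Import all_boot.

Set Implicit Arguments.
Unset Strict Implicit.
Unset Printing Implicit Defensive.

Record signature := Signature {
  pred_sym : eqType;
  arity : pred_sym -> nat;
  cst_sym : eqType
}.

Section Language.
Context (L : signature).

Inductive term := Par of nat | Cst of cst_sym L.

(* Variables are not terms: they only hold the argument places bound by
   quantifiers, so substituting a term for a variable never captures. *)
Inductive arg := Var of nat | Tm of term.

Coercion Tm : term >-> arg.

Definition sum_of_term (t : term) : nat + cst_sym L :=
  match t with Par a => inl a | Cst c => inr c end.
Definition term_of_sum (s : nat + cst_sym L) : term :=
  match s with inl a => Par a | inr c => Cst c end.
Lemma sum_of_termK : cancel sum_of_term term_of_sum.
Proof. by case. Qed.
HB.instance Definition _ :=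
  hasDecEq.Build term (inj_eqAxiom (can_inj sum_of_termK)).

Definition sum_of_arg (s : arg) : nat + term :=
  match s with Var x => inl x | Tm t => inr t end.
Definition arg_of_sum (s : nat + term) : arg :=
  match s with inl x => Var x | inr t => Tm t end.
Lemma sum_of_argK : cancel sum_of_arg arg_of_sum.
Proof. by case. Qed.
HB.instance Definition _ :=
  hasDecEq.Build arg (inj_eqAxiom (can_inj sum_of_argK)).

(* [Exi s] is the primitive predication "s exists"; [The x F G] is Ix[F, G]. *)
Inductive form :=
| Pred (P : pred_sym L) (v : (arity P).-tuple arg)
| Eq of arg & arg
| Exi of arg
| Bot
| And of form & form
| Or of form & form
| Imp of form & form
| Iff of form & form
| All of nat & form
| Ex of nat & form
| The of nat & form & form.

Lemma form_comparable : comparable form.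
Proof.
rewrite /comparable /decidable.
elim=> [P v|s1 s2|s||A1 IH1 A2 IH2|A1 IH1 A2 IH2|A1 IH1 A2 IH2|A1 IH1 A2 IH2
  |x A1 IH1|x A1 IH1|x A1 IH1 A2 IH2]
  [Q w|s3 s4|s5||B1 B2|B1 B2|B1 B2|B1 B2|y B1|y B1|y B1 B2];
  try by [right | left].
- have [E|NE] := P =P Q; last by right=> -[/NE].
  case: Q / E w => w; have [->|NE] := v =P w; first by left.
  right=> H; apply: NE; apply: val_inj.
  pose f A := if A is Pred P v then val v else [::].
  exact: (congr1 f H).
- have [->|NE] := s1 =P s3; last by right=> -[/NE].
  by have [->|NE] := s2 =P s4; [left | right=> -[/NE]].
- by have [->|NE] := s =P s5; [left | right=> -[/NE]].
- case: (IH1 B1) => [->|NE]; last by right=> -[/NE].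
  by case: (IH2 B2) => [->|NE]; [left | right=> -[/NE]].
- case: (IH1 B1) => [->|NE]; last by right=> -[/NE].
  by case: (IH2 B2) => [->|NE]; [left | right=> -[/NE]].
- case: (IH1 B1) => [->|NE]; last by right=> -[/NE].
  by case: (IH2 B2) => [->|NE]; [left | right=> -[/NE]].
- case: (IH1 B1) => [->|NE]; last by right=> -[/NE].
  by case: (IH2 B2) => [->|NE]; [left | right=> -[/NE]].
- have [->|NE] := x =P y; last by right=> -[/NE].
  by case: (IH1 B1) => [->|NE]; [left | right=> -[/NE]].
- have [->|NE] := x =P y; last by right=> -[/NE].
  by case: (IH1 B1) => [->|NE]; [left | right=> -[/NE]].
- have [->|NE] := x =P y; last by right=> -[/NE].
  case: (IH1 B1) => [->|NE]; last by right=> -[/NE].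
  by case: (IH2 B2) => [->|NE]; [left | right=> -[/NE]].
Qed.
HB.instance Definition _ := hasDecEq.Build form (compareP form_comparable).

Definition arg_subst (x : nat) (t : term) (s : arg) : arg :=
  if s is Var y then if x == y then Tm t else s else s.

Fixpoint subst (x : nat) (t : term) (A : form) : form :=
  match A with
  | Pred P v => Pred (map_tuple (arg_subst x t) v)
  | Eq s1 s2 => Eq (arg_subst x t s1) (arg_subst x t s2)
  | Exi s => Exi (arg_subst x t s)
  | Bot => Bot
  | And B C => And (subst x t B) (subst x t C)
  | Or B C => Or (subst x t B) (subst x t C)
  | Imp B C => Imp (subst x t B) (subst x t C)
  | Iff B C => Iff (subst x t B) (subst x t C)
  | All y B => if x == y then A else All y (subst x t B)
  | Ex y B => if x == y then A else Ex y (subst x t B)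
  | The y B C => if x == y then A else The y (subst x t B) (subst x t C)
  end.

Fixpoint occurs (a : nat) (A : form) : bool :=
  match A with
  | Pred P v => Tm (Par a) \in val v
  | Eq s1 s2 => Tm (Par a) \in [:: s1; s2]
  | Exi s => s == Tm (Par a)
  | Bot => false
  | And B C | Or B C | Imp B C | Iff B C | The _ B C => occurs a B || occurs a C
  | All _ B | Ex _ B => occurs a B
  end.

Fixpoint free (x : nat) (A : form) : bool :=
  match A with
  | Pred P v => Var x \in val v
  | Eq s1 s2 => Var x \in [:: s1; s2]
  | Exi s => s == Var x
  | Bot => false
  | And B C | Or B C | Imp B C | Iff B C => free x B || free x C
  | All y B | Ex y B => (x != y) && free x B
  | The y B C => (x != y) && (free x B || free x C)
  end.

(* Formulas in deductions have no free variables; parameters play that role. *)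
Definition sentence (A : form) : Prop := forall x, ~~ free x A.

Definition atomic (A : form) : bool :=
  match A with Pred _ _ | Eq _ _ | Exi _ => true | _ => false end.

(* Instances of the inference rules, with the values of their schematic
   letters. *)
Inductive rule :=
| AndI (A B : form)
| AndE1 (A B : form)
| AndE2 (A B : form)
| OrI1 (A B : form)
| OrI2 (A B : form)
| OrE (A B C : form)
| ImpI (A B : form)
| ImpE (A B : form)
| IffI (A B : form)
| IffE1 (A B : form)
| IffE2 (A B : form)
| BotE (A : form)
| AllI (x : nat) (A : form) (a : nat)
| AllE (x : nat) (A : form) (t : term)
| ExI (x : nat) (A : form) (t : term)
| ExE (x : nat) (A : form) (a : nat) (C : form)
| EqI (t : term)
| EqE (x : nat) (A : form) (t1 t2 : term)
| TheI (x : nat) (F G : form) (t : term) (a : nat)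
| TheE1 (x : nat) (F G : form) (t : term) (a b : nat) (C : form)
| TheE2 (x : nat) (F A : form) (t1 t2 : term)
| TheE3 (x : nat) (F : form) (a : nat) (C : form)
| TheE4 (x : nat) (F A : form) (t1 t2 : term)
| TheE5 (x : nat) (F : form) (t : term) (a : nat) (C : form).

Record premise := Premise {
  prem : form;
  discharged : seq form;
  eigen : option nat
}.

Definition plain (A : form) := Premise A [::] None.
Definition under (Hs : seq form) (A : form) := Premise A Hs None.
Definition under_eigen (a : nat) (Hs : seq form) (A : form) :=
  Premise A Hs (Some a).

Local Notation "A `[ x := t ]" := (subst x t A)
  (at level 8, x at level 60, t at level 60, format "A `[ x  :=  t ]").

(* The major premise of an elimination rule comes first. *)
Definition premises (r : rule) : seq premise :=
  match r with
  | AndI A B => [:: plain A; plain B]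
  | AndE1 A B | AndE2 A B => [:: plain (And A B)]
  | OrI1 A B => [:: plain A]
  | OrI2 A B => [:: plain B]
  | OrE A B C => [:: plain (Or A B); under [:: A] C; under [:: B] C]
  | ImpI A B => [:: under [:: A] B]
  | ImpE A B => [:: plain (Imp A B); plain A]
  | IffI A B => [:: under [:: A] B; under [:: B] A]
  | IffE1 A B => [:: plain (Iff A B); plain A]
  | IffE2 A B => [:: plain (Iff A B); plain B]
  | BotE A => [:: plain Bot]
  | AllI x A a => [:: under_eigen a [:: Exi (Par a)] A`[x := Par a]]
  | AllE x A t => [:: plain (All x A); plain (Exi t)]
  | ExI x A t => [:: plain A`[x := t]; plain (Exi t)]
  | ExE x A a C =>
      [:: plain (Ex x A); under_eigen a [:: A`[x := Par a]; Exi (Par a)] C]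
  | EqI t => [::]
  | EqE x A t1 t2 => [:: plain (Eq t1 t2); plain A`[x := t1]]
  | TheI x F G t a =>
      [:: plain F`[x := t]; plain G`[x := t]; plain (Exi t);
          under_eigen a [:: F`[x := Par a]; Exi (Par a)] (Eq (Par a) t)]
  | TheE1 x F G t a b C =>
      [:: plain (The x F G); plain F`[x := t]; plain (Exi t);
          under_eigen a [:: F`[x := Par a]; Exi (Par a)] (Eq (Par a) t);
          under_eigen b [:: F`[x := Par b]; G`[x := Par b]; Exi (Par b)] C]
  | TheE2 x F A t1 t2 =>
      [:: plain (The x F (Exi (Var x))); plain (Exi t1); plain (Exi t2);
          plain F`[x := t1]; plain F`[x := t2]; plain A`[x := t1]]
  | TheE3 x F a C =>
      [:: plain (The x F (Exi (Var x)));
          under_eigen a [:: F`[x := Par a]; Exi (Par a)] C]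
  | TheE4 x F A t1 t2 =>
      [:: plain (The x F (Eq (Var x) t2)); plain (Exi t1); plain (Exi t2);
          plain F`[x := t1]; plain A`[x := t1]]
  | TheE5 x F t a C =>
      [:: plain (The x F (Eq (Var x) t)); plain (Exi t);
          under_eigen a [:: F`[x := Par a]; Exi (Par a)] C]
  end.

Definition conclusion (r : rule) : form :=
  match r with
  | AndI A B => And A B
  | AndE1 A B => A
  | AndE2 A B => B
  | OrI1 A B | OrI2 A B => Or A B
  | OrE A B C => C
  | ImpI A B => Imp A B
  | ImpE A B => B
  | IffI A B => Iff A B
  | IffE1 A B => B
  | IffE2 A B => A
  | BotE A => A
  | AllI x A a => All x A
  | AllE x A t => A`[x := t]
  | ExI x A t => Ex x A
  | ExE x A a C => C
  | EqI t => Eq t t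
  | EqE x A t1 t2 => A`[x := t2]
  | TheI x F G t a => The x F G
  | TheE1 x F G t a b C => C
  | TheE2 x F A t1 t2 => A`[x := t2]
  | TheE3 x F a C => C
  | TheE4 x F A t1 t2 => A`[x := t2]
  | TheE5 x F t a C => C
  end.

(* The restrictions on a rule instance itself; those on the undischarged
   assumptions of its subdeductions are in [deduction]. *)
Definition side_condition (r : rule) : bool :=
  match r with
  | BotE A => atomic A
  | AllI x A a => ~~ occurs a A
  | ExE x A a C => ~~ occurs a A && ~~ occurs a C
  | EqE x A t1 t2 => atomic A && (t1 != t2)
  | TheI x F G t a => [&& ~~ occurs a F, ~~ occurs a G & t != Par a]
  | TheE1 x F G t a b C =>
      [&& ~~ occurs a F, ~~ occurs a G, ~~ occurs a C, t != Par a,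
          ~~ occurs b F, ~~ occurs b G & ~~ occurs b C]
  | TheE2 x F A t1 t2 | TheE4 x F A t1 t2 => atomic A
  | TheE3 x F a C => ~~ occurs a F && ~~ occurs a C
  | TheE5 x F t a C => [&& ~~ occurs a F, ~~ occurs a C & t != Par a]
  | _ => true
  end.

Definition is_intro (r : rule) : bool :=
  match r with
  | AndI _ _ | OrI1 _ _ | OrI2 _ _ | ImpI _ _ | IffI _ _ | AllI _ _ _
  | ExI _ _ _ | EqI _ | TheI _ _ _ _ _ => true
  | _ => false
  end.

Definition is_elim (r : rule) : bool := ~~ is_intro r.

Definition is_del (r : rule) : bool :=
  match r with
  | OrE _ _ _ | ExE _ _ _ _ | TheE1 _ _ _ _ _ _ _ | TheE3 _ _ _ _
  | TheE5 _ _ _ _ _ => true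
  | _ => false
  end.

(* Assumptions and inferences carry numerals: an inference numbered i
   discharges, above each of its premises, the assumptions numbered i of the
   forms displayed in the rule.  Vacuous and multiple discharge are allowed. *)
Inductive tree :=
| Assume (i : nat) (A : form)
| Infer (i : nat) (r : rule) (ds : seq tree).

Definition concl (d : tree) : form :=
  match d with Assume _ A => A | Infer _ r _ => conclusion r end.

(* [open d j B]: an assumption B numbered j is undischarged in d. *)
Inductive open : tree -> nat -> form -> Prop :=
| open_assume i A : open (Assume i A) i A
| open_infer i r ds k d q j B :
    onth ds k = Some d -> onth (premises r) k = Some q ->
    open d j B -> ~~ ((j == i) && (B \in discharged q)) ->
    open (Infer i r ds) j B.

Definition undischarged (d : tree) (A : form) : Prop := exists i, open d i A.

Inductive deduction : tree -> Prop :=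
| deduction_assume i A : sentence A -> deduction (Assume i A)
| deduction_infer i r ds :
    map concl ds = map prem (premises r) ->
    sentence (conclusion r) ->
    side_condition r ->
    (forall k d q a, onth ds k = Some d -> onth (premises r) k = Some q ->
       eigen q = Some a ->
       forall j B, open d j B -> ~~ ((j == i) && (B \in discharged q)) ->
       ~~ occurs a B) ->
    (forall k d, onth ds k = Some d -> deduction d) ->
    deduction (Infer i r ds).

(* Formula occurrences in a tree are addressed by paths from the root; the
   k-th premise of the inference at p is at [rcons p k]. *)
Definition pos := seq nat.

Fixpoint subtree (d : tree) (p : pos) : option tree :=
  if p is k :: p' then
    if d is Infer _ _ ds then obind (fun e => subtree e p') (onth ds k)
    else None
  else Some d.

Definition formula_at (d : tree) (p : pos) : option form :=
  omap concl (subtree d p).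

Definition concludes (R : pred rule) (d : tree) (p : pos) : Prop :=
  exists i r ds, subtree d p = Some (Infer i r ds) /\ R r.

Definition occurrence (d : tree) (p : pos) : Prop := subtree d p <> None.

Definition major_premise (d : tree) (p : pos) : Prop :=
  occurrence d p /\ exists q, p = rcons q 0 /\ concludes is_elim d q.

(* p is a minor premise of a del-rule whose conclusion is at q. *)
Definition del_minor (d : tree) (p q : pos) : Prop :=
  occurrence d p /\ (exists k, p = rcons q k.+1) /\ concludes is_del d q.

Definition maximal_formula (d : tree) (p : pos) : Prop :=
  concludes is_intro d p /\ major_premise d p.

Definition segment (d : tree) (s : seq pos) : Prop :=
  [/\ 2 <= size s,
      exists C, forall p, p \in s -> formula_at d p = Some C,
      ~ concludes is_del d (head [::] s),
      ~ (exists q, del_minor d (last [::] s) q) &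
      forall i, i.+1 < size s -> del_minor d (nth [::] s i) (nth [::] s i.+1)].

Definition maximal_segment (d : tree) (s : seq pos) : Prop :=
  segment d s /\ major_premise d (last [::] s).

Definition normal (d : tree) : Prop :=
  ~ (exists p, maximal_formula d p) /\ ~ (exists s, maximal_segment d s).

End Language.

(* Main.v *)
(** Call a deduction neutral if it ends with an assumption or with an elimination
    that is not a del-rule, and normal if all its major premises are neutral; this
    amounts to the absence of maximal formulas and maximal segments.  Normal
    deducibility is compared with a Beth-style model whose worlds are finite
    lists of assumptions: a world forces [A] if, after finitely many del-rules
    with neutral major premises have been applied backwards, it either has a
    neutral deduction of [A] or satisfies the condition under which [A] could be
    introduced, read semantically.  The neutral alternative is what gives
    [The x F G] a meaning, since its eliminations do not recover the premises of
    its introduction.  Forced sentences have normal deductions by induction on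
    the sentence, and every rule of the calculus preserves forcing under all
    substitutions of terms for parameters; so the conclusion of a deduction is
    forced in the world of its undischarged assumptions. *)
Require Import Defs.
From mathcomp Require Import all_boot.
From mathcomp Require Import zify.

Set Implicit Arguments.
Unset Strict Implicit.
Unset Printing Implicit Defensive.

Section Normalization.
Context (L : signature).
Implicit Types (A B C F G : form L) (X Y Z : seq (form L)) (s t : term L).
Implicit Types (r : rule L) (q : premise L) (d : tree L).

Local Notation "A `[ x := t ]" := (subst x t A)
  (at level 8, x at level 60, t at level 60, format "A `[ x  :=  t ]").

(* [onth] recurses on the index, so [onth [::] k] does not compute. *)
#[local] Hint Extern 0 => match goal with
  | H : onth [::] ?k = Some _ |- _ => destruct k; discriminate H end : core.

(** * Substitution for variables, sentences, and fresh parameters *)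

Lemma mem_arg_subst x t y (v : seq (arg L)) :
  (Var L y \in map (arg_subst x t) v) = (x != y) && (Var L y \in v).
Proof.
elim: v => [|[z|u] v IH] /=; first by rewrite andbF.
  rewrite !in_cons IH.
  have [->|nxz] := eqVneq x z; last first.
    by have [[->]|] := eqVneq (Var L y) (Var L z); rewrite ?nxz.
  have [//|nzy] := eqVneq z y.
  suff -> : (Var L y == Var L z) = false by [].
  by apply/eqP => -[e]; rewrite e eqxx in nzy.
by rewrite !in_cons IH.
Qed.

(** Terms contain no variables, so a substitution removes [x] and introduces nothing. Hence being a
    sentence does not depend on which term is inserted. *)
Lemma free_subst x t y A : free y A`[x := t] = (x != y) && free y A.
Proof.
have one v : (arg_subst x t v == Var L y) = (x != y) && (v == Var L y).
  by have := mem_arg_subst x t y [:: v]; rewrite /= !inE ![_ == Var L y]eq_sym.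
elim: A => [P v|s1 s2|v||A IHA B IHB|A IHA B IHB|A IHA B IHB|A IHA B IHB
  |z A IH|z A IH|z A IHA B IHB] //=; rewrite ?IHA ?IHB -?andb_orr ?andbF //.
- exact: mem_arg_subst.
- exact: (mem_arg_subst x t y [:: s1; s2]).
- by case: eqP => [<-|_] /=; rewrite 1?eq_sym ?IH; case: eqP => //; rewrite andbCA.
- by case: eqP => [<-|_] /=; rewrite 1?eq_sym ?IH; case: eqP => //; rewrite andbCA.
- case: eqP => [<-|_] /=; first by rewrite eq_sym; case: eqP.
  by rewrite IHA IHB -andb_orr andbCA.
Qed.

Lemma sentence_subst x t s A : sentence A`[x := t] -> sentence A`[x := s].
Proof. by move=> h y; have := h y; rewrite !free_subst. Qed.

Lemma sentence_inst x t A :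
  (forall y, ~~ ((y != x) && free y A)) -> sentence A`[x := t].
Proof. by move=> h y; rewrite free_subst eq_sym. Qed.

Lemma sentence_binary A B :
  (forall y, ~~ (free y A || free y B)) -> sentence A /\ sentence B.
Proof. by move=> h; split=> y; have := h y; rewrite negb_or => /andP[]. Qed.

Lemma sentence_The x F G t :
  sentence (The x F G) -> sentence F`[x := t] /\ sentence G`[x := t].
Proof.
move=> h; split; apply: sentence_inst => y; apply: contra (h y) => /= /andP[-> ->] //.
by rewrite orbT.
Qed.

Lemma sentence_Exi t : sentence (Exi t). Proof. by []. Qed.

(** Freshness is given by a threshold, so that finitely many requirements combine by taking a
    maximum. *)
Lemma fresh_form A : exists N, forall a, N <= a -> ~~ occurs a A.
Proof.
have fresh_args (v : seq (arg L)) :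
    exists N, forall a, N <= a -> Tm (Par L a) \notin v.
  elim: v => [|u v [N IH]]; first by exists 0.
  have [M hM] : exists M, forall a, M <= a -> Tm (Par L a) != u.
    case: u => [y|[b|c]]; try by exists 0.
    by exists b.+1 => a ba; apply/eqP => -[e]; rewrite e ltnn in ba.
  exists (maxn M N) => a; rewrite geq_max => /andP[/hM ha /IH hb].
  by rewrite in_cons negb_or ha.
have join B C : (exists N, forall a, N <= a -> ~~ occurs a B) ->
    (exists N, forall a, N <= a -> ~~ occurs a C) ->
    exists N, forall a, N <= a -> ~~ (occurs a B || occurs a C).
  move=> [M hM] [N hN]; exists (maxn M N) => a.
  by rewrite geq_max negb_or => /andP[/hM -> /hN ->].
elim: A => [P v|s1 s2|v||A IHA B IHB|A IHA B IHB|A IHA B IHB|A IHA B IHB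
  |z A IH|z A IH|z A IHA B IHB] //=; try exact: join.
- have [N hN] := fresh_args [:: v].
  by exists N => a /hN; rewrite inE eq_sym.
- by exists 0.
Qed.

(** [Exi t] stands in for the term [t], which can thus be listed among the formulas given to
    [fresh_seq]. *)
Lemma fresh_term a t : ~~ occurs a (Exi t) -> t != Par L a.
Proof. by apply: contraNneq => -> /=. Qed.

Lemma fresh_seq X : exists N, forall a, N <= a -> {in X, forall B, ~~ occurs a B}.
Proof.
elim: X => [|A X [N IH]]; first by exists 0.
have [M hM] := fresh_form A.
exists (maxn M N) => a; rewrite geq_max => /andP[/hM ha /IH hb] B.
by rewrite in_cons => /predU1P[->|/hb].
Qed.

(** * Normal deducibility *)

(* [nd true] consists of the normal deductions that can serve as the major
   premise of an elimination: those ending neither with an introduction nor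
   with a del-rule.  The eigenparameter ranges over almost all [a]. *)
Inductive nd : bool -> seq (form L) -> form L -> Prop :=
| nd_hyp (b : bool) X A : A \in X -> sentence A -> nd b X A
| nd_infer (b : bool) X A (R : nat -> rule L) N :
    sentence A ->
    (forall a, N <= a ->
       [/\ conclusion (R a) = A, side_condition (R a),
           b -> ~~ is_intro (R a) && ~~ is_del (R a)
         & forall k q, onth (premises (R a)) k = Some q ->
           eigen q = None \/ eigen q = Some a]) ->
    (forall a k q, N <= a -> onth (premises (R a)) k = Some q ->
       nd ((k == 0) && is_elim (R a)) (discharged q ++ X) (prem q)) ->
    nd b X A.

Lemma nd_sentence b X A : nd b X A -> sentence A.
Proof. by case. Qed.

(** The flag restricts the last inference only; the flags of the premises depend on the rule, so the
    same inference serves for either value. *)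
Lemma ne_nf b X A : nd true X A -> nd b X A.
Proof.
move=> h; case: b => //.
have : true = true by []; move: h; move: {1 3}true => b; case=> {b} b.
  by move=> Y B h1 h2 _; apply: nd_hyp.
move=> Y B R N h1 h2 h3 _; apply: (nd_infer (R := R) (N := N)) => // a /h2[] //.
Qed.

(** The threshold survives unchanged because [nd] does not ask the eigenparameter to be fresh for
    the assumptions; that is arranged only when a tree is extracted. *)
Lemma nd_weaken b X Y A : {subset X <= Y} -> nd b X A -> nd b Y A.
Proof.
move=> + h; elim: h Y => {b X A} [b X A AX sA|b X A R N sA hR _ IH] Y XY.
  by apply: nd_hyp => //; apply: XY.
apply: (nd_infer (R := R) (N := N)) => // a k q aN hq; apply: (IH a k q) => //.
by move=> B; rewrite !mem_cat => /orP[->//|/XY ->]; rewrite orbT.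
Qed.

(** The case of a rule without eigenparameter, where the family of instances is constant. *)
Lemma nd_rule (b : bool) X r :
  sentence (conclusion r) -> side_condition r ->
  (b -> ~~ is_intro r && ~~ is_del r) ->
  (forall k q, onth (premises r) k = Some q ->
     eigen q = None /\
     nd ((k == 0) && is_elim r) (discharged q ++ X) (prem q)) ->
  nd b X (conclusion r).
Proof.
move=> h1 h2 h3 h4; apply: (nd_infer (R := fun _ => r) (N := 0)) => // a.
  by move=> _; split=> // k q /h4[]; left.
by move=> k q _ /h4[].
Qed.

(* The del-rules whose major and auxiliary premises are derivable from [X]; the
   second argument lists, for each minor premise, the assumptions discharged. *)
Inductive split X : (nat -> seq (seq (form L))) -> Prop :=
| split_or A B : nd true X (Or A B) -> split X (fun _ => [:: [:: A]; [:: B]])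
| split_ex x A : nd true X (Ex x A) ->
    split X (fun a => [:: [:: A`[x := Par L a]; Exi (Par L a)]])
| split_the1 x F G t : nd true X (The x F G) ->
    nd false X F`[x := t] -> nd false X (Exi t) ->
    (forall a, nd false ([:: F`[x := Par L a]; Exi (Par L a)] ++ X)
                        (Eq (Par L a) t)) ->
    split X (fun a =>
      [:: [:: F`[x := Par L a]; G`[x := Par L a]; Exi (Par L a)]])
| split_the3 x F : nd true X (The x F (Exi (Var L x))) ->
    split X (fun a => [:: [:: F`[x := Par L a]; Exi (Par L a)]])
| split_the5 x F t : nd true X (The x F (Eq (Var L x) t)) ->
    nd false X (Exi t) ->
    split X (fun a => [:: [:: F`[x := Par L a]; Exi (Par L a)]]).

Lemma subset_catl X Y Z : {subset X <= Y} -> {subset Z ++ X <= Z ++ Y}.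
Proof. by move=> h B; rewrite !mem_cat => /orP[->//|/h ->]; rewrite orbT. Qed.

Lemma subset_catr X Y : {subset Y <= X ++ Y}.
Proof. by move=> B h; rewrite mem_cat h orbT. Qed.

Lemma split_weaken X Y Hs : {subset X <= Y} -> split X Hs -> split Y Hs.
Proof.
move=> XY; have w b A : nd b X A -> nd b Y A by apply: nd_weaken.
case=> [A B /w h|x A /w h|x F G t /w h /w h1 /w h2 h3|x F /w h|x F t /w h /w h1].
- exact: split_or.
- exact: split_ex.
- apply: (split_the1 h h1 h2) => a.
  by apply: nd_weaken (h3 a); apply: subset_catl.
- exact: split_the3.
- exact: split_the5 h h1.
Qed.

(** Each split is read back as its del-rule with conclusion [C]; the threshold is chosen beyond the
    parameters of all formulas and terms in the side condition. *)
Lemma split_nd X Hs C : sentence C -> split X Hs ->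
  (forall a H, H \in Hs a -> nd false (H ++ X) C) -> nd false X C.
Proof.
move=> sC; case=> [A B h|x A h|x F G t h h1 h2 h3|x F h|x F t h h1] hC.
- apply: (nd_rule (r := OrE A B C)) => // k q.
  by case: k => [|[|[|k]]] //= [<-]; split=> //; apply: (hC 0); rewrite !inE eqxx ?orbT.
- have [N hN] := fresh_seq [:: A; C].
  apply: (nd_infer (R := fun a => ExE x A a C) (N := N)) => // a.
    move=> /hN Na; split=> //=; first by rewrite !Na ?inE ?eqxx ?orbT.
    by case=> [|[|k]] q //= [<-]; [left|right].
  by case=> [|[|k]] q //= _ [<-] //; apply: (hC a); rewrite inE.
- have [N hN] := fresh_seq [:: F; G; C; Exi t].
  (* One parameter serves as both eigenparameters, since they belong to different subdeductions. *)
  apply: (nd_infer (R := fun a => TheE1 x F G t a a C) (N := N)) => // a.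
    move=> /hN Na; split=> //=; last first.
      by case=> [|[|[|[|[|k]]]]] q //= [<-]; [left|left|left|right|right].
    rewrite !Na ?inE ?eqxx ?orbT //= andbT.
    by apply: fresh_term; apply: Na; rewrite !inE eqxx !orbT.
  by case=> [|[|[|[|[|k]]]]] q //= _ [<-]; [| | |exact: h3|apply: (hC a); rewrite inE].
- have [N hN] := fresh_seq [:: F; C].
  apply: (nd_infer (R := fun a => TheE3 x F a C) (N := N)) => // a.
    move=> /hN Na; split=> //=; first by rewrite !Na ?inE ?eqxx ?orbT.
    by case=> [|[|k]] q //= [<-]; [left|right].
  by case=> [|[|k]] q //= _ [<-] //; apply: (hC a); rewrite inE.
- have [N hN] := fresh_seq [:: F; C; Exi t].
  apply: (nd_infer (R := fun a => TheE5 x F t a C) (N := N)) => // a.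
    move=> /hN Na; split=> //=; last first.
      by case=> [|[|[|k]]] q //= [<-]; [left|left|right].
    rewrite !Na ?inE ?eqxx ?orbT //=.
    by apply: fresh_term; apply: Na; rewrite !inE eqxx !orbT.
  by case=> [|[|[|k]]] q //= _ [<-] //; apply: (hC a); rewrite inE.
Qed.

(** The Beth covering relation: [P] holds at the leaves of a well-founded tree of splits. A split
    branches over every parameter [a] as well as over its minor premises. *)
Inductive cover (P : seq (form L) -> Prop) : seq (form L) -> Prop :=
| cover_ret X : P X -> cover P X
| cover_split X Hs : split X Hs ->
    (forall a H, H \in Hs a -> cover P (H ++ X)) -> cover P X.

Lemma cover_weaken (P : seq (form L) -> Prop) X Y :
  (forall Z W, {subset Z <= W} -> P Z -> P W) ->
  {subset X <= Y} -> cover P X -> cover P Y.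
Proof.
move=> hP + h; elim: h Y => {X} [X h|X Hs h _ IH] Y XY.
  exact: cover_ret (hP _ _ XY h).
apply: (cover_split (split_weaken XY h)) => a H hH.
by apply: (IH a H hH); apply: subset_catl.
Qed.

(** Covers of [Q] are grafted onto the leaves of a cover of [P]; the worlds only grow along it. *)
Lemma cover_bind (P Q : seq (form L) -> Prop) X :
  cover P X -> (forall Y, {subset X <= Y} -> P Y -> cover Q Y) -> cover Q X.
Proof.
elim=> {X} [X h|X Hs h _ IH] hPQ; first exact: hPQ.
apply: (cover_split h) => a H hH; apply: (IH a H hH) => Y HY.
by apply: hPQ => B BX; apply: HY; apply: subset_catr.
Qed.

(** The splits of the cover become del-rules at the bottom of the deduction, where their conclusion
    is not the major premise of anything. *)
Lemma cover_nd X C : sentence C ->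
  cover (fun Y => nd false Y C) X -> nd false X C.
Proof. by move=> sC; elim=> {X} // X Hs h _; apply: split_nd. Qed.

(** * Forcing *)

Fixpoint depth A : nat :=
  match A with
  | Pred _ _ | Eq _ _ | Exi _ | Bot => 0
  | And B C | Or B C | Imp B C | Iff B C | The _ B C =>
      (maxn (depth B) (depth C)).+1
  | All _ B | Ex _ B => (depth B).+1
  end.

Lemma depth_subst x t A : depth A`[x := t] = depth A.
Proof.
elim: A => //= [A -> B ->|A -> B ->|A -> B ->|A -> B ->|z A IH|z A IH
  |z A IHA B IHB] //; by case: eqP => //= _; rewrite ?IH ?IHA ?IHB.
Qed.

(** One layer of the semantics, with [R] for the immediate components. [Pred], [Exi] and [Bot] have
    no introduction rule. The clauses matching a discharge quantify over larger worlds. *)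
Definition val (R : seq (form L) -> form L -> Prop) X A : Prop :=
  match A with
  | Pred _ _ | Exi _ | Bot => False
  | Eq u v => u = v
  | And B C => R X B /\ R X C
  | Or B C => R X B \/ R X C
  | Imp B C => forall Y, {subset X <= Y} -> R Y B -> R Y C
  | Iff B C => forall Y, {subset X <= Y} -> (R Y B -> R Y C) /\ (R Y C -> R Y B)
  | All x B => forall Y t, {subset X <= Y} -> R Y (Exi t) -> R Y B`[x := t]
  | Ex x B => exists t, R X B`[x := t] /\ R X (Exi t)
  | The x F G => exists t, [/\ R X F`[x := t], R X G`[x := t], R X (Exi t) &
      forall Y s, {subset X <= Y} -> R Y F`[x := s] -> R Y (Exi s) ->
                  R Y (Eq s t)]
  end.

Lemma val_weaken (R : seq (form L) -> form L -> Prop) X Y A :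
  (forall Z W B, {subset Z <= W} -> R Z B -> R W B) ->
  {subset X <= Y} -> val R X A -> val R Y A.
Proof.
move=> hR XY; have w B : R X B -> R Y B by apply: hR.
have tr Z : {subset Y <= Z} -> {subset X <= Z} by move=> YZ B /XY /YZ.
case: A => //= [B C [/w h1 /w h2]|B C [/w|/w]|B C h Z /tr /h|B C h Z /tr /h
  |x B h Z t /tr /h|x B [t [/w h1 /w h2]]|x F G [t [/w h1 /w h2 /w h3 h]]] //; auto.
  by exists t.
by exists t; split=> // Z s /tr XZ; apply: h.
Qed.

Lemma val_ext (R S : seq (form L) -> form L -> Prop) X A :
  (forall Y B, depth B < depth A -> R Y B <-> S Y B) ->
  val R X A -> val S X A.
Proof.
case: A => //= [B C|B C|B C|B C|x B|x B|x F G] RS.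
- by move=> [h1 h2]; split; apply/RS => //; rewrite ltnS leq_max leqnn ?orbT.
- by move=> [h|h]; [left|right]; apply/RS => //; rewrite ltnS leq_max leqnn ?orbT.
- by move=> h Y XY /RS hB; apply/RS; [lia|apply: h => //; apply: hB; lia].
- move=> h Y XY; have [h1 h2] := h Y XY.
  by split=> /RS hB; apply/RS; try lia; [apply: h1|apply: h2]; apply: hB; lia.
- move=> h Y t XY /RS hE; apply/RS; first by rewrite depth_subst.
  by apply: h => //; apply: hE.
- by move=> [t [h1 h2]]; exists t; split; apply/RS; rewrite ?depth_subst.
- move=> [t [h1 h2 h3 h]]; exists t; split; try by (apply/RS; rewrite ?depth_subst //; lia).
  move=> Y s XY /RS hF /RS hE; apply/RS => //; apply: h => //.
    by apply: hF; rewrite depth_subst; lia.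
  exact: hE.
Qed.

(** Recursion is on fuel because an instance of a quantified formula is not a subterm of it;
    [depth], which substitution preserves, bounds the fuel required. *)
Fixpoint forceN n X A : Prop :=
  if n is m.+1 then cover (fun Y => nd true Y A \/ val (forceN m) Y A) X
  else False.

Definition force X A := forceN (depth A).+1 X A.

Lemma forceN_weaken n X Y A : {subset X <= Y} -> forceN n X A -> forceN n Y A.
Proof.
elim: n X Y A => //= n IH X Y A; apply: cover_weaken => Z W ZW [h|h].
  by left; apply: nd_weaken h.
by right; apply: val_weaken h => //.
Qed.

Lemma force_weaken X Y A : {subset X <= Y} -> force X A -> force Y A.
Proof. exact: forceN_weaken. Qed.

(** [val] consults only formulas of smaller depth, so any two sufficient amounts of fuel agree. *)
Lemma forceN_fuel n m X A : depth A < n -> depth A < m ->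
  forceN n X A <-> forceN m X A.
Proof.
elim: n m X A => // n IH [//|m] X A nA mA /=.
split=> h; apply: (cover_bind h) => {h} Y _ h; apply: cover_ret.
all: case: h => h; [by left | right; apply: val_ext h => Z B hB].
  by apply: IH; lia.
by symmetry; apply: IH; lia.
Qed.

Lemma forceE X A :
  force X A <-> cover (fun Y => nd true Y A \/ val force Y A) X.
Proof.
rewrite {1}/force /=; split=> h; apply: (cover_bind h) => {h} Y _ h; apply: cover_ret.
all: case: h => h; [by left | right; apply: val_ext h => Z B hB].
  exact: forceN_fuel.
exact: forceN_fuel.
Qed.

Lemma force_ne X A : nd true X A -> force X A.
Proof. by move=> h; apply/forceE/cover_ret; left. Qed.

Lemma force_hyp X A : A \in X -> sentence A -> force X A.
Proof. by move=> h s; apply/force_ne/nd_hyp. Qed.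

Lemma force_val X A : val force X A -> force X A.
Proof. by move=> h; apply/forceE/cover_ret; right. Qed.

(** Forcing of [C] is itself a cover and absorbs the cover of [A]. An elimination need therefore be
    checked only for a neutral or a canonically forced major premise. *)
Lemma force_bind X A C : force X A ->
  (forall Y, {subset X <= Y} -> nd true Y A -> force Y C) ->
  (forall Y, {subset X <= Y} -> val force Y A -> force Y C) ->
  force X C.
Proof.
move=> /forceE h h1 h2; apply/forceE; apply: (cover_bind h) => {h} Y XY h.
by apply/forceE; case: h; [apply: h1|apply: h2].
Qed.

Lemma force_split X Hs C : split X Hs ->
  (forall a H, H \in Hs a -> force (H ++ X) C) -> force X C.
Proof.
move=> h hC; apply/forceE; apply: (cover_split h) => a H /hC.
by move/forceE.
Qed.

(** Induction on depth: the cover is turned into final del-rules, and at a leaf either a neutral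
    deduction is kept or the introduction rule of [A] is applied. A discharged assumption is
    neutral, hence forced, in the extended world. *)
Lemma reify X A : sentence A -> force X A -> nd false X A.
Proof.
have [n] := ubnP (depth A); elim: n X A => // n IH X A An sA /forceE h.
apply: cover_nd => //; apply: (cover_bind h) => {h} {}X _ h.
apply: cover_ret; case: h => [|h]; first exact: ne_nf.
case: A An sA h => //=.
- move=> u v _ + uv; rewrite -{}uv; case: u => [y|t] sA.
    by have := sA y; rewrite /= inE eqxx.
  by apply: (nd_rule (r := EqI t)) => // -[].
- move=> B C An sA [h1 h2]; have [sB sC] := sentence_binary sA.
  apply: (nd_rule (r := AndI B C)) => // -[|[|k]] q //= [<-]; split=> //=.
    by apply: IH => //; lia.
  by apply: IH => //; lia.
- move=> B C An sA; have [sB sC] := sentence_binary sA.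
  case=> h.
    apply: (nd_rule (r := OrI1 B C)) => // -[|k] q //= [<-]; split=> //=.
    by apply: IH => //; lia.
  apply: (nd_rule (r := OrI2 B C)) => // -[|k] q //= [<-]; split=> //=.
  by apply: IH => //; lia.
- move=> B C An sA h; have [sB sC] := sentence_binary sA.
  apply: (nd_rule (r := ImpI B C)) => // -[|k] q //= [<-]; split=> //=.
  apply: IH => //; first lia.
  apply: h; first by apply: (@subset_catr [:: B]).
  by apply: force_hyp; rewrite // inE eqxx.
- move=> B C An sA h; have [sB sC] := sentence_binary sA.
  apply: (nd_rule (r := IffI B C)) => // -[|[|k]] q //= [<-]; split=> //=.
    apply: IH => //; first lia.
    apply: (proj1 (h _ _)); first by apply: (@subset_catr [:: B]).
    by apply: force_hyp; rewrite // inE eqxx.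
  apply: IH => //; first lia.
  apply: (proj2 (h _ _)); first by apply: (@subset_catr [:: C]).
  by apply: force_hyp; rewrite // inE eqxx.
- move=> x B An sA h; have [N hN] := fresh_form B.
  apply: (nd_infer (R := fun a => AllI x B a) (N := N)) => // a.
    by move=> /hN aB; split=> //= -[|k] q //= [<-]; right.
  move=> [|k] q //= _ [<-] /=; apply: IH; rewrite ?depth_subst //.
    exact: sentence_inst.
  (* The clause for [All] is used at the eigenparameter itself, whose existence is the assumption
     added. *)
  apply: h; first by apply: (@subset_catr [:: _]).
  by apply: force_hyp; rewrite // inE eqxx.
- move=> x B An sA [t [h1 h2]].
  apply: (nd_rule (r := ExI x B t)) => // -[|[|k]] q //= [<-]; split=> //=.
    by apply: IH; rewrite ?depth_subst //; apply: sentence_inst.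
  by apply: IH => //=; lia.
- move=> x F G An sA [t [h1 h2 h3 h]]; have [sF sG] := sentence_The t sA.
  have [N hN] := fresh_seq [:: F; G; Exi t].
  apply: (nd_infer (R := fun a => TheI x F G t a) (N := N)) => // a.
    move=> /hN Na; split=> //=; last first.
      by case=> [|[|[|[|k]]]] q //= [<-]; [left|left|left|right].
    rewrite !Na ?inE ?eqxx ?orbT //=.
    by apply: fresh_term; apply: Na; rewrite !inE eqxx !orbT.
  case=> [|[|[|[|k]]]] q //= _ [<-] //=; apply: IH; rewrite /= ?depth_subst //; try lia.
  (* Only the uniqueness premise remains; its clause is taken at the eigenparameter. *)
  have [sFa _] := sentence_The (Par L a) sA.
  apply: h; first by apply: (@subset_catr [:: _; _]).
    by apply: force_hyp; rewrite // !inE eqxx ?orbT.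
  by apply: force_hyp; rewrite // !inE eqxx ?orbT.
Qed.

(** A neutral major premise followed by a non-del elimination is again neutral; the other premises
    are supplied by [reify]. *)
Lemma ne_rule X r :
  ~~ is_intro r -> ~~ is_del r ->
  sentence (conclusion r) -> side_condition r ->
  (forall k q, onth (premises r) k = Some q ->
     [/\ eigen q = None, discharged q = [::],
         k = 0 -> nd true X (prem q)
       & 0 < k -> sentence (prem q) /\ force X (prem q)]) ->
  force X (conclusion r).
Proof.
move=> h1 h2 h3 h4 h; apply/force_ne/nd_rule => //; first by rewrite h1 h2.
case=> [|k] q /h [-> -> hk hk'] /=; split=> //; rewrite /is_elim ?h1.
  exact: hk.
by have [] := hk' isT; apply: reify.
Qed.

(** * Forcing is closed under the elimination rules *)

Lemma force_AndE X A B : force X (And A B) -> force X A /\ force X B.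
Proof.
by move=> h; split; apply: (force_bind h) => Y _ => [n|[]//];
  have [sA sB] := sentence_binary (nd_sentence n);
  [apply: (ne_rule (r := AndE1 A B))|apply: (ne_rule (r := AndE2 A B))];
  rewrite //= => -[|k] q //= [<-].
Qed.

(** A canonical disjunction selects its case; a neutral one gives a split, in each branch of which
    the new assumption is forced. The other del-rules follow this pattern. *)
Lemma force_OrE X A B C : force X (Or A B) ->
  (forall Y, {subset X <= Y} -> force Y A -> force Y C) ->
  (forall Y, {subset X <= Y} -> force Y B -> force Y C) -> force X C.
Proof.
move=> h hA hB; apply: (force_bind h) => Y XY; last by move=> [/hA|/hB]; apply.
move=> n; have [sA sB] := sentence_binary (nd_sentence n).
apply: (force_split (split_or n)) => _ H; rewrite !inE => /orP[] /eqP ->.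
  apply: hA => [D /XY DY|]; first exact: subset_catr.
  by apply: force_hyp; rewrite // inE eqxx.
apply: hB => [D /XY DY|]; first exact: subset_catr.
by apply: force_hyp; rewrite // inE eqxx.
Qed.

Lemma force_ImpE X A B : force X (Imp A B) -> force X A -> force X B.
Proof.
move=> h hA; apply: (force_bind h) => Y XY n; have {}hA := force_weaken XY hA.
  have [sA sB] := sentence_binary (nd_sentence n).
  by apply: (ne_rule (r := ImpE A B)) => //= -[|[|k]] q //= [<-].
exact: n.
Qed.

Lemma force_IffE X A B : force X (Iff A B) ->
  (force X A -> force X B) /\ (force X B -> force X A).
Proof.
move=> h; split=> hA; apply: (force_bind h) => Y XY n; have {}hA := force_weaken XY hA.
- have [sA sB] := sentence_binary (nd_sentence n).
  by apply: (ne_rule (r := IffE1 A B)) => //= -[|[|k]] q //= [<-].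
- exact: (proj1 (n Y _)).
- have [sA sB] := sentence_binary (nd_sentence n).
  by apply: (ne_rule (r := IffE2 A B)) => //= -[|[|k]] q //= [<-].
- exact: (proj2 (n Y _)).
Qed.

Lemma force_BotE X A : atomic A -> sentence A -> force X (Bot L) -> force X A.
Proof.
move=> aA sA h; apply: (force_bind h) => Y _ n //.
by apply: (ne_rule (r := BotE A)) => //= -[|k] q //= [<-].
Qed.

Lemma force_AllE X x A t :
  force X (All x A) -> force X (Exi t) -> force X A`[x := t].
Proof.
move=> h hE; apply: (force_bind h) => Y XY n; have {}hE := force_weaken XY hE.
  apply: (ne_rule (r := AllE x A t)) => //=.
    exact: sentence_inst (nd_sentence n).
  by move=> [|[|k]] q //= [<-].
exact: n.
Qed.

Lemma force_ExE X x A C : force X (Ex x A) ->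
  (forall Y t, {subset X <= Y} -> force Y A`[x := t] -> force Y (Exi t) ->
     force Y C) -> force X C.
Proof.
move=> h hC; apply: (force_bind h) => Y XY n; last first.
  by case: n => t []; apply: hC.
apply: (force_split (split_ex n)) => a H; rewrite inE => /eqP ->.
apply: (hC _ (Par L a)) => [D /XY DY||]; first exact: subset_catr.
  apply: force_hyp; rewrite ?inE ?eqxx //.
  exact: sentence_inst (nd_sentence n).
by apply: force_hyp; rewrite // !inE eqxx orbT.
Qed.

(** The rule requires distinct terms, so equal ones are set aside first; after that a canonical
    equality is impossible. *)
Lemma force_EqE X x A t1 t2 : atomic A -> sentence A`[x := t1] ->
  force X (Eq t1 t2) -> force X A`[x := t1] -> force X A`[x := t2].
Proof.
move=> aA sA h hA; have [<-//|ne] := eqVneq t1 t2.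
apply: (force_bind h) => Y XY n; last by case: n => e; rewrite e eqxx in ne.
have {}hA := force_weaken XY hA.
apply: (ne_rule (r := EqE x A t1 t2)); rewrite //= ?aA //.
  exact: sentence_subst sA.
by move=> [|[|k]] q //= [<-].
Qed.

(** Replacement in the formula [x = t1], whose instance at [t1] is forced canonically. *)
Lemma force_Eq_sym X t1 t2 : force X (Eq t1 t2) -> force X (Eq t2 t1).
Proof.
move=> h; have := @force_EqE X 0 (Eq (Var L 0) t1) t1 t2.
by apply=> //; apply: force_val.
Qed.

(** In the canonical case the witness comes from the forcing of [The x F G] and need not be [t]. In
    the neutral case the auxiliary premises are reified to form the split. *)
Lemma force_TheE1 X x F G t C : force X (The x F G) ->
  force X F`[x := t] -> force X (Exi t) ->
  (forall Y s, {subset X <= Y} -> force Y F`[x := s] -> force Y (Exi s) ->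
     force Y (Eq s t)) ->
  (forall Y s, {subset X <= Y} -> force Y F`[x := s] -> force Y G`[x := s] ->
     force Y (Exi s) -> force Y C) -> force X C.
Proof.
move=> h hF hE hu hC; apply: (force_bind h) => Y XY n; last first.
  by case: n => s [h1 h2 h3 _]; apply: (hC Y s).
have sT s := sentence_The s (nd_sentence n).
have sub H : {subset X <= H ++ Y} by move=> D /XY; apply: subset_catr.
apply: (force_split (split_the1 (t := t) n _ _ _)).
- by apply: reify (force_weaken XY hF); case: (sT t).
- exact: reify (force_weaken XY hE).
- move=> a; apply: reify => //; apply: hu => //.
    by apply: force_hyp; rewrite ?inE ?eqxx //; case: (sT (Par L a)).
  by apply: force_hyp; rewrite // !inE eqxx ?orbT.
- move=> a H; rewrite inE => /eqP ->; have [sF sG] := sT (Par L a).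
  by apply: (hC _ (Par L a)) => //; apply: force_hyp; rewrite // !inE eqxx ?orbT.
Qed.

Lemma force_TheE2 X x F A t1 t2 : atomic A -> sentence A`[x := t1] ->
  force X (The x F (Exi (Var L x))) -> force X (Exi t1) -> force X (Exi t2) ->
  force X F`[x := t1] -> force X F`[x := t2] -> force X A`[x := t1] ->
  force X A`[x := t2].
Proof.
move=> aA sA h hE1 hE2 hF1 hF2 hA; apply: (force_bind h) => Y XY n.
  have sF s := (sentence_The s (nd_sentence n)).1.
  apply: (ne_rule (r := TheE2 x F A t1 t2)) => //=.
    exact: sentence_subst sA.
  by case=> [|[|[|[|[|[|k]]]]]] q //= [<-] //=; split=> // _; split=> //;
    apply: force_weaken XY _.
(* Uniqueness equates both [t1] and [t2] with the witness [t], through which [A] is carried in two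
   replacements. *)
case: n => t [_ _ _ hu]; have w B := @force_weaken X Y B XY.
apply: (@force_EqE Y x A t t2) => //; first exact: sentence_subst sA.
  by apply: force_Eq_sym; apply: hu => //; apply: w.
by apply: (@force_EqE Y x A t1 t) => //; [apply: hu => // | ]; apply: w.
Qed.

Lemma force_TheE3 X x F C : force X (The x F (Exi (Var L x))) ->
  (forall Y s, {subset X <= Y} -> force Y F`[x := s] -> force Y (Exi s) ->
     force Y C) -> force X C.
Proof.
move=> h hC; apply: (force_bind h) => Y XY n; last first.
  by case: n => s [h1 _ h3 _]; apply: (hC Y s).
have sub H : {subset X <= H ++ Y} by move=> D /XY; apply: subset_catr.
apply: (force_split (split_the3 n)) => a H; rewrite inE => /eqP ->.
have [sF _] := sentence_The (Par L a) (nd_sentence n).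
by apply: (hC _ (Par L a)) => //; apply: force_hyp; rewrite // !inE eqxx ?orbT.
Qed.

Lemma force_TheE4 X x F A t1 t2 : atomic A -> sentence A`[x := t1] ->
  force X (The x F (Eq (Var L x) t2)) -> force X (Exi t1) -> force X (Exi t2) ->
  force X F`[x := t1] -> force X A`[x := t1] -> force X A`[x := t2].
Proof.
move=> aA sA h hE1 hE2 hF1 hA; apply: (force_bind h) => Y XY n.
  have sF s := (sentence_The s (nd_sentence n)).1.
  apply: (ne_rule (r := TheE4 x F A t1 t2)) => //=.
    exact: sentence_subst sA.
  by case=> [|[|[|[|[|k]]]]] q //= [<-] //=; split=> // _; split=> //;
    apply: force_weaken XY _.
(* Here the second component of the description, instantiated at the witness, is the equality of [t]
   with [t2]. *)
case: n => t [_ /= + _ hu]; rewrite eqxx => ht; have w B := @force_weaken X Y B XY.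
apply: (@force_EqE Y x A t t2) => //; first exact: sentence_subst sA.
by apply: (@force_EqE Y x A t1 t) => //; [apply: hu => // | ]; apply: w.
Qed.

Lemma force_TheE5 X x F t C : force X (The x F (Eq (Var L x) t)) ->
  force X (Exi t) ->
  (forall Y s, {subset X <= Y} -> force Y F`[x := s] -> force Y (Exi s) ->
     force Y C) -> force X C.
Proof.
move=> h hE hC; apply: (force_bind h) => Y XY n; last first.
  by case: n => s [h1 _ h3 _]; apply: (hC Y s).
have sub H : {subset X <= H ++ Y} by move=> D /XY; apply: subset_catr.
have nE := reify (@sentence_Exi t) (force_weaken XY hE).
apply: (force_split (split_the5 n nE)) => a H; rewrite inE => /eqP ->.
have [sF _] := sentence_The (Par L a) (nd_sentence n).
by apply: (hC _ (Par L a)) => //; apply: force_hyp; rewrite // !inE eqxx ?orbT.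
Qed.

(** * Soundness *)

Definition psub_term (f : nat -> term L) t : term L :=
  if t is Par a then f a else t.

Definition psub_arg f (u : arg L) : arg L :=
  if u is Tm t then Tm (psub_term f t) else u.

(** Simultaneous replacement of parameters; it passes under binders without capture since its values
    are closed terms. *)
Fixpoint psub f A : form L :=
  match A with
  | Pred P v => Pred (map_tuple (psub_arg f) v)
  | Eq u v => Eq (psub_arg f u) (psub_arg f v)
  | Exi u => Exi (psub_arg f u)
  | Bot => Bot L
  | And B C => And (psub f B) (psub f C)
  | Or B C => Or (psub f B) (psub f C)
  | Imp B C => Imp (psub f B) (psub f C)
  | Iff B C => Iff (psub f B) (psub f C)
  | All x B => All x (psub f B)
  | Ex x B => Ex x (psub f B)
  | The x B C => The x (psub f B) (psub f C)
  end.

Lemma psub_subst f x t A :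
  psub f A`[x := t] = (psub f A)`[x := psub_term f t].
Proof.
have one u : psub_arg f (arg_subst x t u) = arg_subst x (psub_term f t) (psub_arg f u).
  by case: u => //= y; case: eqP.
elim: A => [P v|u v|u||A IHA B IHB|A IHA B IHB|A IHA B IHB|A IHA B IHB
  |z A IH|z A IH|z A IHA B IHB] //=; rewrite ?one ?IHA ?IHB //.
- congr Pred; apply: val_inj; rewrite /= -!map_comp.
  by apply: eq_map => u /=.
- by case: eqP => //= _; rewrite IH.
- by case: eqP => //= _; rewrite IH.
- by case: eqP => //= _; rewrite IHA IHB.
Qed.

Lemma free_psub f y A : free y (psub f A) = free y A.
Proof.
have mem (v : seq (arg L)) : (Var L y \in map (psub_arg f) v) = (Var L y \in v).
  by elim: v => [|[z|u] v IH] //; rewrite map_cons !in_cons IH.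
elim: A => [P v|u v|u||A IHA B IHB|A IHA B IHB|A IHA B IHB|A IHA B IHB
  |z A IH|z A IH|z A IHA B IHB] //=; rewrite ?IHA ?IHB ?IH //.
- exact: (mem [:: u; v]).
- by have := mem [:: u]; rewrite /= !inE ![_ == Var L y]eq_sym.
Qed.

Lemma sentence_psub f A : sentence A -> sentence (psub f A).
Proof. by move=> h y; rewrite free_psub. Qed.

Lemma atomic_psub f A : atomic (psub f A) = atomic A.
Proof. by case: A. Qed.

Lemma eq_psub f g A : (forall a, occurs a A -> f a = g a) -> psub f A = psub g A.
Proof.
have mem (v : seq (arg L)) : (forall a, Tm (Par L a) \in v -> f a = g a) ->
    map (psub_arg f) v = map (psub_arg g) v.
  move=> h; apply/eq_in_map => -[y|[a|c]] //= /h -> //.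
have bin B C : (forall a, occurs a B || occurs a C -> f a = g a) ->
    (forall a, occurs a B -> f a = g a) /\ (forall a, occurs a C -> f a = g a).
  by move=> h; split=> a ha; apply: h; rewrite ha ?orbT.
elim: A => [P v|u v|u||A IHA B IHB|A IHA B IHB|A IHA B IHB|A IHA B IHB
  |z A IH|z A IH|z A IHA B IHB] //= h.
- by congr Pred; apply: val_inj; apply: mem.
- by have /= [-> ->] := mem [:: u; v] h.
- have /mem : forall a, Tm (Par L a) \in [:: u] -> f a = g a.
    by move=> a; rewrite inE eq_sym; apply: h.
  by case=> ->.
- by have [h1 h2] := bin _ _ h; rewrite IHA ?IHB.
- by have [h1 h2] := bin _ _ h; rewrite IHA ?IHB.
- by have [h1 h2] := bin _ _ h; rewrite IHA ?IHB.
- by have [h1 h2] := bin _ _ h; rewrite IHA ?IHB.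
- by rewrite IH.
- by rewrite IH.
- by have [h1 h2] := bin _ _ h; rewrite IHA ?IHB.
Qed.

Lemma psub_id A : psub (Par L) A = A.
Proof.
have one u : psub_arg (Par L) u = u by case: u => [y|[a|c]].
elim: A => [P v|u v|u||A IHA B IHB|A IHA B IHB|A IHA B IHB|A IHA B IHB
  |z A IH|z A IH|z A IHA B IHB] //=; rewrite ?one ?IHA ?IHB ?IH //.
by congr Pred; apply: val_inj; rewrite /= (eq_map one) map_id.
Qed.

Definition upd (f : nat -> term L) a t : nat -> term L :=
  fun b => if b == a then t else f b.

Lemma psub_upd f a t A : ~~ occurs a A -> psub (upd f a t) A = psub f A.
Proof.
move=> h; apply: eq_psub => b hb; rewrite /upd; case: eqP => // e.
by rewrite -e hb in h.
Qed.

(** By freshness, an instance at the eigenparameter can be made to denote the instance at any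
    term. *)
Lemma psub_upd_subst f a t x A : ~~ occurs a A ->
  psub (upd f a t) A`[x := Par L a] = (psub f A)`[x := t].
Proof. by move=> h; rewrite psub_subst psub_upd //= /upd eqxx. Qed.

(** The semantic reading of a subdeduction: it is valid in every larger world forcing the discharged
    assumptions, with every term as value of the eigenparameter. *)
Definition premise_valid f X q : Prop :=
  match eigen q with
  | None => forall Y, {subset X <= Y} ->
      {in discharged q, forall B, force Y (psub f B)} -> force Y (psub f (prem q))
  | Some a => forall Y t, {subset X <= Y} ->
      {in discharged q, forall B, force Y (psub (upd f a t) B)} ->
      force Y (psub (upd f a t) (prem q))
  end.

Lemma premise_valid_plain f X A :
  premise_valid f X (plain A) -> force X (psub f A).
Proof. by move=> /(_ X); apply. Qed.

Lemma premise_valid_under f X A B : premise_valid f X (under [:: A] B) ->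
  forall Y, {subset X <= Y} -> force Y (psub f A) -> force Y (psub f B).
Proof.
move=> h Y XY hA; apply: (h Y XY) => C; rewrite inE => /eqP ->.
exact: hA.
Qed.

Lemma premise_valid_eigen f X a x F C :
  premise_valid f X (under_eigen a [:: F`[x := Par L a]; Exi (Par L a)] C) ->
  ~~ occurs a F -> forall Y t, {subset X <= Y} ->
  force Y (psub f F)`[x := t] -> force Y (Exi t) ->
  force Y (psub (upd f a t) C).
Proof.
move=> h aF Y t XY hF hE; apply: (h Y t XY) => B.
by rewrite !inE => /orP[] /eqP ->; rewrite ?psub_upd_subst //= /upd eqxx.
Qed.

(** The restriction that [t] is not the eigenparameter keeps its value unaffected by the update. *)
Lemma premise_valid_eq f X a x F t :
  premise_valid f X
    (under_eigen a [:: F`[x := Par L a]; Exi (Par L a)] (Eq (Par L a) t)) ->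
  ~~ occurs a F -> t != Par L a -> forall Y s, {subset X <= Y} ->
  force Y (psub f F)`[x := s] -> force Y (Exi s) ->
  force Y (Eq s (psub_term f t)).
Proof.
move=> h aF ta Y s XY hF hE; have := premise_valid_eigen h aF XY hF hE.
rewrite /= {1}/upd eqxx; congr (force Y (Eq _ (Tm _))).
case: t ta {h} => //= b ba; rewrite /upd; case: eqP => // e.
by rewrite e eqxx in ba.
Qed.

(** Introductions establish the matching clause of [val]; eliminations use the closure lemmas above,
    after [psub] has been commuted with [subst]. *)
Lemma rule_sound f X r : sentence (conclusion r) -> side_condition r ->
  (forall k q, onth (premises r) k = Some q -> sentence (prem q)) ->
  (forall k q, onth (premises r) k = Some q -> premise_valid f X q) ->
  force X (psub f (conclusion r)).
Proof.
move=> sr cr sp hp.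
have pl k A : onth (premises r) k = Some (plain A) -> force X (psub f A).
  by move=> /hp; apply: premise_valid_plain.
have un k A B : onth (premises r) k = Some (under [:: A] B) ->
    forall Y, {subset X <= Y} -> force Y (psub f A) -> force Y (psub f B).
  by move=> /hp; apply: premise_valid_under.
have ei k a x F C : onth (premises r) k =
      Some (under_eigen a [:: F`[x := Par L a]; Exi (Par L a)] C) ->
    ~~ occurs a F -> ~~ occurs a C -> forall Y t, {subset X <= Y} ->
    force Y (psub f F)`[x := t] -> force Y (Exi t) -> force Y (psub f C).
  move=> /hp h aF aC Y t XY hF hE.
  by rewrite -(psub_upd f t aC); apply: premise_valid_eigen h _ _ _ _ _ _.
case: r sr cr sp hp pl un ei => [A B|A B|A B|A B|A B|A B C|A B|A B|A B|A B|A B|A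
  |x A a|x A t|x A t|x A a C|t|x A t1 t2|x F G t a|x F G t a b C|x F A t1 t2
  |x F a C|x F A t1 t2|x F t a C] /= sr cr sp hp pl un ei.
- by apply: force_val; split; [apply: (pl 0)|apply: (pl 1)].
- by have /= /force_AndE[] := pl 0 _ erefl.
- by have /= /force_AndE[] := pl 0 _ erefl.
- by apply: force_val; left; apply: (pl 0).
- by apply: force_val; right; apply: (pl 0).
- exact: force_OrE (pl 0 _ erefl) (un 1 _ _ erefl) (un 2 _ _ erefl).
- by apply: force_val => /=; apply: (un 0).
- exact: force_ImpE (pl 0 _ erefl) (pl 1 _ erefl).
- apply: force_val => Y XY.
  by split; [apply: (un 0 _ _ erefl)|apply: (un 1 _ _ erefl)].
- exact: (force_IffE (pl 0 _ erefl)).1 (pl 1 _ erefl).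
- exact: (force_IffE (pl 0 _ erefl)).2 (pl 1 _ erefl).
- apply: force_BotE (pl 0 _ erefl); first by rewrite atomic_psub.
  exact: sentence_psub.
- apply: force_val => Y t XY hE; have := hp 0 _ erefl Y t XY.
  rewrite /= psub_upd_subst //; apply=> B; rewrite inE => /eqP ->.
  by rewrite /= /upd eqxx.
- rewrite psub_subst.
  exact: force_AllE (pl 0 _ erefl) (pl 1 _ erefl).
- apply: force_val; exists (psub_term f t); split; last exact: (pl 1 _ erefl).
  by rewrite -psub_subst; apply: (pl 0).
- have /andP[aA aC] := cr.
  exact: force_ExE (pl 0 _ erefl) (ei 1 a x A C erefl aA aC).
- exact: force_val.
- have /andP[aA _] := cr; rewrite psub_subst.
  apply: (@force_EqE X x (psub f A) (psub_term f t1)).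
  + by rewrite atomic_psub.
  + by rewrite -psub_subst; apply: sentence_psub; exact: (sp 1 _ erefl).
  + exact: (pl 0 _ erefl).
  + by rewrite -psub_subst; apply: (pl 1).
- have /and3P[aF _ ta] := cr.
  apply: force_val; exists (psub_term f t); split.
  + by rewrite -psub_subst; apply: (pl 0).
  + by rewrite -psub_subst; apply: (pl 1).
  + exact: (pl 2 _ erefl).
  + exact: premise_valid_eq (hp 3 _ erefl) aF ta.
- have /and5P[aF _ _ ta /and3P[bF bG bC]] := cr.
  apply: (force_TheE1 (pl 0 _ erefl) (t := psub_term f t)).
  + by rewrite -psub_subst; apply: (pl 1).
  + exact: (pl 2 _ erefl).
  + exact: premise_valid_eq (hp 3 _ erefl) aF ta.
  (* This premise discharges three assumptions, so [ei], made for two, does not fit. *)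
  + move=> Y s XY hF hG hE; rewrite -(psub_upd f s bC).
    apply: (hp 4 _ erefl Y s XY) => B; rewrite !inE.
    by case/or3P=> /eqP ->; rewrite ?psub_upd_subst //= /upd eqxx.
- rewrite psub_subst.
  apply: (@force_TheE2 X x (psub f F) (psub f A) (psub_term f t1)); rewrite -?psub_subst.
  + by rewrite atomic_psub.
  + by apply: sentence_psub; exact: (sp 5 _ erefl).
  + exact: (pl 0 _ erefl).
  + exact: (pl 1 _ erefl).
  + exact: (pl 2 _ erefl).
  + exact: (pl 3 _ erefl).
  + exact: (pl 4 _ erefl).
  + exact: (pl 5 _ erefl).
- have /andP[aF aC] := cr.
  exact: force_TheE3 (pl 0 _ erefl) (ei 1 a x F C erefl aF aC).
- rewrite psub_subst.
  apply: (@force_TheE4 X x (psub f F) (psub f A) (psub_term f t1)); rewrite -?psub_subst.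
  + by rewrite atomic_psub.
  + by apply: sentence_psub; exact: (sp 4 _ erefl).
  + exact: (pl 0 _ erefl).
  + exact: (pl 1 _ erefl).
  + exact: (pl 2 _ erefl).
  + exact: (pl 3 _ erefl).
  + exact: (pl 4 _ erefl).
- have /and3P[aF aC _] := cr.
  exact: force_TheE5 (pl 0 _ erefl) (pl 1 _ erefl) (ei 2 a x F C erefl aF aC).
Qed.

(** * Soundness of deductions and finiteness of their assumptions *)

Lemma onth_premise (ds : seq (tree L)) (qs : seq (premise L)) k q :
  map (@concl L) ds = map (@prem L) qs -> onth qs k = Some q ->
  exists2 d, onth ds k = Some d & concl d = prem q.
Proof.
elim: k ds qs => [|k IH] [|d ds] [|q' qs] //= [e1 e2].
  by case=> <-; exists d.
exact: IH.
Qed.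

Lemma deduction_sentence d : deduction d -> sentence (concl d).
Proof. by case. Qed.

Lemma open_Infer i r ds j B : open (Infer i r ds) j B -> exists k d q,
  [/\ onth ds k = Some d, onth (premises r) k = Some q, open d j B
    & ~~ ((j == i) && (B \in discharged q))].
Proof.
move e: (Infer i r ds) => d0 h.
case: h e => // i' r' ds' k d q j' B' hk hq o nB [-> -> ->].
by exists k, d, q.
Qed.

Lemma open_sentence d j B : deduction d -> open d j B -> sentence B.
Proof.
move=> + o; elim: o => {d j B} [i A|i r ds k d q j B hk _ _ IH _] h.
  exact: deduction_sentence h.
by apply: IH; inversion h; eauto.
Qed.

(** An assumption open in a subdeduction is either discharged by the last inference, hence forced by
    validity of the premise, or still open in the whole. [f] must vary in the induction because of
    eigenparameters. *)
Lemma deduction_sound d : deduction d -> forall f X,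
  (forall j B, open d j B -> force X (psub f B)) -> force X (psub f (concl d)).
Proof.
elim=> {d} [i A sA|i r ds hc sr cr he hd IH] f X hX.
  by apply: (hX i); constructor.
apply: rule_sound => // k q hq.
  have [d hk <-] := onth_premise hc hq.
  by apply: deduction_sentence; apply: hd hk.
rewrite /premise_valid; case ea: (eigen q) => [a|].
  move=> Y t XY hH; have [d' hk' <-] := onth_premise hc hq.
  apply: (IH k d' hk') => j B oB.
  have [/andP[_ /hH //]|nB] := boolP ((j == i) && (B \in discharged q)).
  (* The eigenparameter does not occur in an assumption left undischarged, so the update is
     harmless. *)
  rewrite psub_upd; last exact: he hk' hq ea _ _ oB nB.
  by apply: force_weaken XY _; apply: (hX j); apply: open_infer hk' hq oB nB.
move=> Y XY hH; have [d' hk' <-] := onth_premise hc hq.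
apply: (IH k d' hk') => j B oB.
have [/andP[_ /hH //]|nB] := boolP ((j == i) && (B \in discharged q)).
by apply: force_weaken XY _; apply: (hX j); apply: open_infer hk' hq oB nB.
Qed.

(** It provides the world, a finite list, in which the conclusion is to be forced. *)
Lemma undischarged_finite d : deduction d ->
  exists X, forall A, A \in X <-> undischarged d A.
Proof.
(* Numerals are kept during the induction, since discharge depends on them. *)
move=> h; suff [S hS] : exists S : seq (nat * form L),
    forall j B, (j, B) \in S <-> open d j B.
  exists (map snd S) => A; split=> [/mapP[[j B] /hS h' ->]|[j /hS h']].
    by exists j.
  by apply/mapP; exists (j, A).
elim: h => {d} [i A _|i r ds hc _ _ _ _ IH].
  exists [:: (i, A)] => j B; rewrite inE; split=> [/eqP[-> ->]|h]; first by constructor.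
  by inversion h; rewrite eqxx.
have [S hS] : exists S : seq (nat * form L), forall j B, (j, B) \in S <->
    exists k d q, [/\ k < size ds, onth ds k = Some d,
      onth (premises r) k = Some q, open d j B
      & ~~ ((j == i) && (B \in discharged q))].
  (* The bound on [k] is generalised, so that premises are added one at a time. *)
  elim: (size ds) => [|n [S hS]]; first by exists [::] => j B; split=> // -[? [? [? []]]].
  case dn: (onth ds n) => [d|]; last first.
    exists S => j B; rewrite hS; split=> -[k [d [q [kn hk]]]].
      by exists k, d, q; split=> //; apply: ltnW.
    move=> hq o nB; exists k, d, q; split=> //.
    by move: kn; rewrite ltnS leq_eqVlt => /predU1P[e|//]; rewrite e dn in hk.
  case qn: (onth (premises r) n) => [q|]; last first.
    exists S => j B; rewrite hS; split=> -[k [d' [q [kn hk hq]]]].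
      by exists k, d', q; split=> //; apply: ltnW.
    move=> o nB; exists k, d', q; split=> //.
    by move: kn; rewrite ltnS leq_eqVlt => /predU1P[e|//]; rewrite e qn in hq.
  have [T hT] := IH _ _ dn.
  exists ([seq h <- T | ~~ ((h.1 == i) && (h.2 \in discharged q))] ++ S) => j B.
  rewrite mem_cat mem_filter; split.
    case/orP=> [/andP[nB /hT o]|/hS [k [d' [q' [kn hk hq o nB]]]]].
      by exists n, d, q.
    by exists k, d', q'; split=> //; apply: ltnW.
  case=> k [d' [q' [+ hk hq o nB]]]; rewrite ltnS leq_eqVlt => /predU1P[e|kn].
    move: hk hq; rewrite {}e dn qn => -[e1] [e2]; rewrite -e1 -e2 in o nB.
    by rewrite nB; move/hT: o => ->.
  by apply/orP; right; apply/hS; exists k, d', q'.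
exists S => j B; rewrite hS; split=> [[k [d [q [_ hk hq o nB]]]]|h].
  exact: open_infer hk hq o nB.
have [k [d [q [hk hq o nB]]]] := open_Infer h.
by exists k, d, q; split=> //; rewrite -onthTE hk.
Qed.

(** * Extraction of a normal deduction *)

(** A local criterion covering both obstacles to normality: the major premise, at index 0, ends with
    an introduction or a del-rule. *)
Definition detour d : Prop := exists p, concludes (@is_elim L) d p /\
  concludes (fun r => is_intro r || is_del r) d (rcons p 0).

(** The last occurrence of a segment is the conclusion of a del-rule, so a maximal segment also
    exhibits a detour. *)
Lemma detour_free_normal d : ~ detour d -> normal d.
Proof.
move=> nd; split=> -[p].
  move=> [[i [r [ds [e hr]]]] [_ [q [pq hq]]]]; apply: nd; exists q.
  by split=> //; exists i, r, ds; rewrite -pq hr.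
move=> [[s2 _ _ _ hs] [_ [q [pq hq]]]]; apply: nd; exists q; split=> //.
(* Here [p] is the segment and the index is that of its last occurrence but one, which exists
   because the length is at least 2. *)
have [] := hs (size p).-2; first by case: p s2 {hs pq} => [|? []].
move=> _ [_ [i [r [ds [e hr]]]]]; exists i, r, ds; rewrite -pq hr orbT.
by split=> //; rewrite -e -nth_last; case: p s2 {hs pq e} => [|? []].
Qed.

Lemma detour_Infer i r ds : detour (Infer i r ds) ->
  (exists k d, onth ds k = Some d /\ detour d) \/
  (is_elim r /\ exists2 d, onth ds 0 = Some d &
     concludes (fun r => is_intro r || is_del r) d [::]).
Proof.
case=> -[|k p] [[i1 [r1 [ds1 [/= e1 h1]]]] [i2 [r2 [ds2 [/= e2 h2]]]]].
  case: e1 => _ e _; right; split; first by rewrite e.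
  case: ds e2 => [|d ds] //= e2; exists d => //.
  by exists i2, r2, ds2.
left; case ek: (onth ds k) e1 e2 => [d|] //= e1 e2.
by exists k, d; split=> //; exists p; split; [exists i1, r1, ds1|exists i2, r2, ds2].
Qed.

(** Finite choice, used to collect the trees obtained for the separate premises into one list. *)
Lemma onth_choice (T U : Type) (s : seq T) (P : nat -> T -> U -> Prop) :
  (forall k x, onth s k = Some x -> exists y, P k x y) ->
  exists2 s' : seq U, size s' = size s &
    forall k x y, onth s k = Some x -> onth s' k = Some y -> P k x y.
Proof.
elim: s P => [|x s IH] P h; first by exists [::] => // -[].
have [y Py] := h 0 x erefl.
have [s' es Ps] := IH (fun k => P k.+1) (fun k => h k.+1).
by exists (y :: s') => [|[|k] z w] /=; [rewrite es|case=> <- [<-]|apply: Ps].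
Qed.

(* Every numeral is 0, so an inference discharges all occurrences of the
   assumptions that it displays. *)
Lemma nd_tree b X A : nd b X A -> exists d,
  [/\ deduction d, concl d = A, forall j B, open d j B -> j = 0 /\ B \in X,
      ~ detour d & b -> ~ concludes (fun r => is_intro r || is_del r) d [::]].
Proof.
elim=> {b X A} [b X A AX sA|b X A R N sA hR _ IH].
  exists (Assume 0 A); split=> //.
  - exact: deduction_assume.
  - by move=> j B h; inversion h; subst.
  - by case=> -[|k p] [[i [r [ds [/= ?]]]]].
  - by move=> _ [i [r [ds []]]].
(* The eigenparameter is now fixed: past [N] for the rule instance, and past [M] to be fresh for the
   undischarged assumptions, all of which lie in [X]. *)
have [M hM] := fresh_seq X; pose a := maxn N M.
have /hR [eA ca na ea] : N <= a by rewrite leq_maxl.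
have /hM fa : M <= a by rewrite leq_maxr.
have [ds es hds] := onth_choice (fun k q => IH a k q (leq_maxl N M)).
have sub k d : onth ds k = Some d -> exists q, onth (premises (R a)) k = Some q.
  move=> hk; case e: (onth _ k) => [q|]; first by exists q.
  have : onth (premises (R a)) k by rewrite onthTE -es -onthTE hk.
  by rewrite e.
exists (Infer 0 (R a) ds); split=> //.
- apply: deduction_infer => //; rewrite ?eA //.
  + apply: eq_from_onth => k; rewrite !onth_map.
    case e: (onth ds k) => [d|].
      have [q hq] := sub _ _ e; have [_ cd _ _ _] := hds _ _ _ hq e.
      by rewrite hq /= cd.
    case e': (onth (premises _) k) => [q|] //.
    have : onth ds k by rewrite onthTE es -onthTE e'.
    by rewrite e.
  + move=> k d q a' hk hq ha j B oB nB.
    have := ea _ _ hq; rewrite ha => -[//|[->]]; apply: fa.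
    have [_ _ /(_ j B oB) [j0 +] _ _] := hds _ _ _ hq hk.
    by rewrite mem_cat => /orP[hB|//]; rewrite j0 hB in nB.
  + by move=> k d hk; have [q hq] := sub _ _ hk; case: (hds _ _ _ hq hk).
- move=> j B /open_Infer[k [d [q [hk hq oB nB]]]].
  have [_ _ /(_ j B oB) [j0 +] _ _] := hds _ _ _ hq hk.
  by rewrite mem_cat => /orP[hB|//]; rewrite j0 hB in nB.
(* A detour at the root is excluded because premise 0 of an elimination was derived with flag
   [true]. *)
- case/detour_Infer=> [[k [d [hk dd]]]|[el [d hd cd]]].
    by have [q hq] := sub _ _ hk; case: (hds _ _ _ hq hk).
  have [q hq] := sub _ _ hd; have [_ _ _ _] := hds _ _ _ hq hd.
  by rewrite el => /(_ isT).
- move=> /na nr [i [r [ds' [[_ <- _]]]]].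
  by case/andP: nr => /negbTE -> /negbTE ->.
Qed.

End Normalization.

Theorem theorem2 (L : signature) (d : tree L) (Hd : deduction d) :
  exists d' : tree L,
    [/\ deduction d',
        concl d' = concl d,
        forall A : form L, undischarged d' A -> undischarged d A
      & normal d'].
Proof.
have [X hX] := undischarged_finite Hd.
have : nd false X (concl d).
  apply: reify; first exact: deduction_sentence.
  (* Soundness is used with the identity substitution, in the world of the undischarged assumptions,
     where each of them is forced as a hypothesis. *)
  rewrite -[concl d]psub_id; apply: deduction_sound => // j B oB.
  by rewrite psub_id; apply: force_hyp; [apply/hX; exists j|exact: open_sentence oB].
move=> /nd_tree [d' [dd' cd' od' nd' _]]; exists d'; split=> //.
  by move=> A [j /od' [_ /hX]].
exact: detour_free_normal.
Qed.
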